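(* Every $\mathbf{B}_h$-consistent set of $\mathcal{H}_\beta(@)$-formulas is satisfiable (in the language expanded by countably many fresh nominals) in a countable named model whose underlying frame validates every betweenness axiom of $\mathbf{B}_h$, i.e. each of (HB1)–(HB7) and (HB8$'$). Hence every $\mathbf{B}_h$-consistent set of formulas is satisfiable on a model based on a countable frame from the class $\mathsf{DLBWE}$.
   Context: A 3-frame is $\mathfrak F=\langle W,B\rangle$ with $B\subseteq W^3$; $B(x,y,z)$ is read ''$y$ lies between $x$ and $z$'', and $\#(x,y,z)$ means $x,y,z$ are pairwise distinct. $\mathsf{DLBWE}$ is the class of 3-frames satisfying (universal closures of): (B1) $B(x,y,z)\to\#(x,y,z)$; (B2) $B(x,y,z)\to B(z,y,x)$; (B3) $B(x,y,z)\to\neg B(x,z,y)$; (B4) $B(x,y,z)\wedge B(y,z,u)\to B(x,y,u)$; (B5) $B(x,y,z)\wedge B(y,u,z)\to B(x,y,u)$; (B6) $\#(x,y,z)\to B(x,y,z)\vee B(x,z,y)\vee B(y,x,z)$; (B7) $\forall y\exists x\exists z\,B(x,y,z)$; (B8) $x\neq z\to\exists y\,B(x,y,z)$. The language $\mathcal H_\beta(@)$ is built from disjoint countable sets $\mathrm{Var}$ of propositional variables and $\mathrm{Nom}$ of nominals: $\varphi::=\top\mid p\mid i\mid\neg\varphi\mid\varphi\wedge\psi\mid\langle B\rangle(\varphi,\psi)\mid @_i\varphi$ (other Boolean connectives as abbreviations). A valuation on $\mathfrak F$ is $V:\mathrm{Var}\cup\mathrm{Nom}\to 2^W$ with $V(i)$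 a singleton for each nominal; a model is $\langle\mathfrak F,V\rangle$. Truth: $w\Vdash p$ iff $w\in V(p)$; $w\Vdash i$ iff $V(i)=\{w\}$; Booleans as usual; $w\Vdash\langle B\rangle(\varphi,\psi)$ iff there are $x,y\in W$ with $x\Vdash\varphi$, $y\Vdash\psi$ and $B(x,w,y)$; $w\Vdash @_i\varphi$ iff the element of $V(i)$ satisfies $\varphi$. Validity on a frame: truth at all points under all valuations. A model is named if every point is the value of some nominal. Write $[B](\varphi,\psi)$ for the dual of $\langle B\rangle$ and $\mathsf C\varphi:=\langle B\rangle(\varphi,\varphi)$. The logic $\mathbf B_h$ has axioms: all propositional tautologies; $\neg\langle B\rangle(p,q)\leftrightarrow[B](\neg p,\neg q)$; $[B](p\to q,r)\to([B](p,r)\to[B](q,r))$; $[B](r,p\to q)\to([B](r,p)\to[B](r,q))$; $@_i(p\to q)\to(@_ip\to @_iq)$; $\neg @_ip\leftrightarrow @_i\neg p$; $@_ii$; $i\wedge p\to @_ip$; $\langle B\rangle(@_ip,q)\to @_ip$; $\langle B\rangle(q,@_ip)\to @_ip$; $@_i@_jp\to @_jp$; $@_ji\to @_ij$; $@_ij\wedge @_jp\to @_ip$; and the betweenness axioms (HB1) $@_i\langle B\rangle(j,k)\to\neg @_ij\wedge\neg @_ik\wedge\neg @_kj$; (HB2) $\langle B\rangle(i,j)\to\langle B\rangle(j,i)$; (HB3) $@_j\langle B\rangle(i,k)\to\neg @_k\langle B\rangle(i,j)$; (HB4) $@_j\langle B\rangle(i,k)\wedge @_k\langle B\rangle(j,l)\to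 @_j\langle B\rangle(i,l)\wedge @_k\langle B\rangle(i,l)$; (HB5) $@_j\langle B\rangle(i,k)\wedge @_l\langle B\rangle(i,j)\to @_l\langle B\rangle(i,k)\wedge @_j\langle B\rangle(l,k)$; (HB6) $\neg @_ij\wedge\neg @_ik\wedge\neg @_kj\to @_j\langle B\rangle(i,k)\vee @_k\langle B\rangle(i,j)\vee @_i\langle B\rangle(j,k)$; (HB7) $\langle B\rangle(\top,\top)$; (HB8$'$) $\langle B\rangle(i,j)\to\mathsf C\mathsf C(i\vee j)$. Rules: modus ponens; from $\vdash\varphi$ infer $\vdash[B](\varphi,\psi)$; from $\vdash\psi$ infer $\vdash[B](\varphi,\psi)$; from $\vdash\varphi$ infer $\vdash @_i\varphi$; uniform substitution (formulas for variables, nominals for nominals); Name: from $\vdash i\to\theta$ infer $\vdash\theta$ if $i$ does not occur in $\theta$; Paste: from $\vdash @_i\langle B\rangle(j,k)\wedge @_j\varphi\wedge @_k\psi\to\theta$ infer $\vdash @_i\langle B\rangle(\varphi,\psi)\to\theta$, provided $i,j,k$ are pairwise distinct and $j,k$ do not occur in $\varphi,\psi,\theta$. *)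

(* Defs.v *)
From mathcomp Require Import all_boot.
From mathcomp Require Import classical_sets functions cardinality.
From Stdlib Require List.

Set Implicit Arguments.
Unset Strict Implicit.
Unset Printing Implicit Defensive.

Local Open Scope classical_set_scope.

Inductive form (Var Nom : Type) : Type :=
| Top
| Prp of Var
| Nml of Nom
| Neg of form Var Nom
| Conj of form Var Nom & form Var Nom
| Dia of form Var Nom & form Var Nom
| At of Nom & form Var Nom.

Arguments Top {Var Nom}.
Arguments Prp {Var Nom} p.
Arguments Nml {Var Nom} i.

Declare Scope hyb_scope.
Delimit Scope hyb_scope with hyb.
Bind Scope hyb_scope with form.

Notation "⊤" := Top : hyb_scope.
Notation "¬ a" := (Neg a) (at level 75, right associativity) : hyb_scope.
Notation "a ∧ b" := (Conj a b) (at level 80, right associativity) : hyb_scope.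
Notation "⟨B⟩( a , b )" := (Dia a b) (at level 0) : hyb_scope.
Notation "@[ i ] a" := (At i a) (at level 75, right associativity) : hyb_scope.
Notation "a ∨ b" := (Neg (Conj (Neg a) (Neg b)))
  (at level 85, right associativity) : hyb_scope.
Notation "a → b" := (Neg (Conj a (Neg b)))
  (at level 99, b at level 200, right associativity) : hyb_scope.

Definition iff_form Var Nom (a b : form Var Nom) : form Var Nom :=
  ((a → b) ∧ (b → a))%hyb.
Definition Box Var Nom (a b : form Var Nom) : form Var Nom :=
  (¬ ⟨B⟩(¬ a, ¬ b))%hyb.
Definition C Var Nom (a : form Var Nom) : form Var Nom := (⟨B⟩(a, a))%hyb.

Notation "a ↔ b" := (iff_form a b) (at level 95, no associativity) : hyb_scope.
Notation "[B]( a , b )" := (Box a b) (at level 0) : hyb_scope.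

Fixpoint occurs Var Nom (n : Nom) (a : form Var Nom) : Prop :=
  match a with
  | Top | Prp _ => False
  | Nml i => i = n
  | Neg b => occurs n b
  | Conj b c | Dia b c => occurs n b \/ occurs n c
  | At i b => i = n \/ occurs n b
  end.

Fixpoint subst Var Nom Var' Nom' (s : Var -> form Var' Nom')
    (t : Nom -> Nom') (a : form Var Nom) : form Var' Nom' :=
  match a with
  | Top => Top
  | Prp p => s p
  | Nml i => Nml (t i)
  | Neg b => Neg (subst s t b)
  | Conj b c => Conj (subst s t b) (subst s t c)
  | Dia b c => Dia (subst s t b) (subst s t c)
  | At i b => At (t i) (subst s t b)
  end.

(* The formulas of the language, read in the language whose nominals are
   enlarged by the set [New]. *)
Definition expand Var Nom New (a : form Var Nom) : form Var (Nom + New) :=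
  subst Prp inl a.

(** * Frames and models *)

Record frame : Type := Frame {
  point :> Type;
  btw : point -> point -> point -> Prop
}.

Definition distinct3 T (x y z : T) : Prop := [/\ x <> y, x <> z & y <> z].

Record DLBWE (F : frame) : Prop := {
  B1 : forall x y z : F, btw x y z -> distinct3 x y z;
  B2 : forall x y z : F, btw x y z -> btw z y x;
  B3 : forall x y z : F, btw x y z -> ~ btw x z y;
  B4 : forall x y z u : F, btw x y z /\ btw y z u -> btw x y u;
  B5 : forall x y z u : F, btw x y z /\ btw y u z -> btw x y u;
  B6 : forall x y z : F, distinct3 x y z -> btw x y z \/ btw x z y \/ btw y x z;
  B7 : forall y : F, exists x z : F, btw x y z;
  B8 : forall x z : F, x <> z -> exists y : F, btw x y z
}.

Record valuation (F : frame) (Var Nom : Type) : Type := Valuation {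
  val :> Var + Nom -> set F;
  val_nom : forall i : Nom, exists w : F, val (inr i) = [set w]
}.

Fixpoint sat (F : frame) Var Nom (V : valuation F Var Nom) (w : F)
    (a : form Var Nom) : Prop :=
  match a with
  | Top => True
  | Prp p => V (inl p) w
  | Nml i => V (inr i) = [set w]
  | Neg b => ~ sat V w b
  | Conj b c => sat V w b /\ sat V w c
  | Dia b c => exists x y : F, [/\ sat V x b, sat V y c & btw x w y]
  | At i b => exists2 u : F, V (inr i) u & sat V u b
  end.

Definition valid (F : frame) Var Nom (a : form Var Nom) : Prop :=
  forall (V : valuation F Var Nom) (w : F), sat V w a.

Definition named (F : frame) Var Nom (V : valuation F Var Nom) : Prop :=
  forall w : F, exists i : Nom, V (inr i) = [set w].

Definition countable_frame (F : frame) : Prop := countable [set: F].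

(** * The logic *)

(* Formulas whose main operator is not Boolean are treated as atoms. *)
Fixpoint beval Var Nom (v : form Var Nom -> bool) (a : form Var Nom) : bool :=
  match a with
  | Top => true
  | Neg b => ~~ beval v b
  | Conj b c => beval v b && beval v c
  | _ => v a
  end.

Definition tautology Var Nom (a : form Var Nom) : Prop :=
  forall v : form Var Nom -> bool, beval v a.

(* In the axioms the letters i, j, k, l range over all nominals and p, q, r over
   all propositional variables, with coincidences allowed: the additional
   instances are substitution instances of those with distinct letters. *)

Inductive betweenness_axiom Var Nom : form Var Nom -> Prop :=
| HB1 i j k : betweenness_axiom
    (@[i] ⟨B⟩(Nml j, Nml k)
       → (¬ @[i] Nml j) ∧ (¬ @[i] Nml k) ∧ (¬ @[k] Nml j))%hyb
| HB2 i j : betweenness_axiom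
    (⟨B⟩(Nml i, Nml j) → ⟨B⟩(Nml j, Nml i))%hyb
| HB3 i j k : betweenness_axiom
    (@[j] ⟨B⟩(Nml i, Nml k) → ¬ @[k] ⟨B⟩(Nml i, Nml j))%hyb
| HB4 i j k l : betweenness_axiom
    ((@[j] ⟨B⟩(Nml i, Nml k)) ∧ (@[k] ⟨B⟩(Nml j, Nml l))
       → (@[j] ⟨B⟩(Nml i, Nml l)) ∧ (@[k] ⟨B⟩(Nml i, Nml l)))%hyb
| HB5 i j k l : betweenness_axiom
    ((@[j] ⟨B⟩(Nml i, Nml k)) ∧ (@[l] ⟨B⟩(Nml i, Nml j))
       → (@[l] ⟨B⟩(Nml i, Nml k)) ∧ (@[j] ⟨B⟩(Nml l, Nml k)))%hyb
| HB6 i j k : betweenness_axiom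
    ((¬ @[i] Nml j) ∧ (¬ @[i] Nml k) ∧ (¬ @[k] Nml j)
       → (@[j] ⟨B⟩(Nml i, Nml k)) ∨ (@[k] ⟨B⟩(Nml i, Nml j))
         ∨ (@[i] ⟨B⟩(Nml j, Nml k)))%hyb
| HB7 : betweenness_axiom (⟨B⟩(⊤, ⊤))%hyb
| HB8' i j : betweenness_axiom
    (⟨B⟩(Nml i, Nml j) → C (C (Nml i ∨ Nml j)))%hyb.

Inductive hybrid_axiom Var Nom : form Var Nom -> Prop :=
| Ax_dual p q : hybrid_axiom
    ((¬ ⟨B⟩(Prp p, Prp q)) ↔ [B](¬ Prp p, ¬ Prp q))%hyb
| Ax_K1 p q r : hybrid_axiom
    ([B](Prp p → Prp q, Prp r)
       → ([B](Prp p, Prp r) → [B](Prp q, Prp r)))%hyb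
| Ax_K2 p q r : hybrid_axiom
    ([B](Prp r, Prp p → Prp q)
       → ([B](Prp r, Prp p) → [B](Prp r, Prp q)))%hyb
| Ax_K_at i p q : hybrid_axiom
    ((@[i] (Prp p → Prp q)) → ((@[i] Prp p) → (@[i] Prp q)))%hyb
| Ax_selfdual i p : hybrid_axiom
    ((¬ @[i] Prp p) ↔ (@[i] ¬ Prp p))%hyb
| Ax_ref i : hybrid_axiom (@[i] Nml i)%hyb
| Ax_intro i p : hybrid_axiom (Nml i ∧ Prp p → @[i] Prp p)%hyb
| Ax_back1 i p q : hybrid_axiom (⟨B⟩(@[i] Prp p, Prp q) → @[i] Prp p)%hyb
| Ax_back2 i p q : hybrid_axiom (⟨B⟩(Prp q, @[i] Prp p) → @[i] Prp p)%hyb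
| Ax_agree i j p : hybrid_axiom ((@[i] @[j] Prp p) → @[j] Prp p)%hyb
| Ax_sym i j : hybrid_axiom ((@[j] Nml i) → @[i] Nml j)%hyb
| Ax_nom i j p : hybrid_axiom
    ((@[i] Nml j) ∧ (@[j] Prp p) → @[i] Prp p)%hyb.

Inductive provable Var Nom : form Var Nom -> Prop :=
| Pr_taut a : tautology a -> provable a
| Pr_hybrid a : hybrid_axiom a -> provable a
| Pr_betweenness a : betweenness_axiom a -> provable a
| Pr_MP a b : provable (a → b)%hyb -> provable a -> provable b
| Pr_nec1 a b : provable a -> provable ([B](a, b))%hyb
| Pr_nec2 a b : provable b -> provable ([B](a, b))%hyb
| Pr_nec_at i a : provable a -> provable (@[i] a)%hyb
| Pr_subst (s : Var -> form Var Nom) (t : Nom -> Nom) a :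
    provable a -> provable (subst s t a)
| Pr_name i c : ~ occurs i c -> provable (Nml i → c)%hyb -> provable c
| Pr_paste i j k a b c :
    distinct3 i j k ->
    ~ occurs j a -> ~ occurs j b -> ~ occurs j c ->
    ~ occurs k a -> ~ occurs k b -> ~ occurs k c ->
    provable ((@[i] ⟨B⟩(Nml j, Nml k)) ∧ (@[j] a) ∧ (@[k] b) → c)%hyb ->
    provable ((@[i] ⟨B⟩(a, b)) → c)%hyb.

Definition consistent Var Nom (G : set (form Var Nom)) : Prop :=
  forall s : seq (form Var Nom), List.Forall G s ->
    ~ provable (¬ foldr (@Conj Var Nom) ⊤ s)%hyb.

(* Main.v *)
(* A consistent set stays consistent in the language with new nominals: the
   enlarged set of nominals is in bijection with the old one, so a refutation can
   be renamed back, and a substitution then restores the original nominals.  The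
   rules Name and Paste allow one to extend it to a maximal consistent set [M]
   that contains a nominal and provides nominal witnesses [j], [k] for each
   [@i <B>(b, c)] in it.  The points of the canonical model are the classes of
   nominals modulo [@i j] in [M]; each [{a | @i a in M}] is again maximal
   consistent, which gives the truth lemma.  Since this model is named, the
   betweenness axioms, true in it for all nominals, turn into the first-order
   conditions of DLBWE on the frame; conversely these conditions make all the
   betweenness axioms valid. *)
Require Import Defs.
From mathcomp Require Import all_boot.
From mathcomp Require Import boolp classical_sets functions cardinality.

Set Implicit Arguments.
Unset Strict Implicit.
Unset Printing Implicit Defensive.

Local Open Scope classical_set_scope.

(** The goals are schematic: [beval] is stuck on a metavariable formula, so its value there is split
    by cases just like that of an atom. *)
Ltac tautology :=
  apply: Pr_taut; let v := fresh "v" in intro v; simpl;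
  repeat match goal with
    | |- context [beval v ?a] => case: (beval v a)
    | |- context [v ?a] => case: (v a)
  end; by [].

(** * Denumerable types and simultaneous substitution *)

Definition denumerable (T : Type) := exists f : nat -> T, bijective f.

Lemma card_nat_denumerable (T : Type) :
  ([set: T] #= [set: nat])%card -> denumerable T.
Proof.
move=> /pcard_eqP[f]; have [g fK gK] : bijective f by exact: bijTT.
by exists g; exists f.
Qed.

Lemma inj_countable (T : Type) (f : T -> nat) : injective f -> countable [set: T].
Proof. by move=> f_inj; apply/countable_injP; exists f => x y _ _ /f_inj. Qed.

(** Injectivity of [f] makes the prescribed values compatible; variables outside its range are sent
    to [Top]. *)
Lemma subst_onto (Var Nom : Type) (f : nat -> Var) (g : nat -> form Var Nom) :
  injective f -> exists s : Var -> form Var Nom, forall n, s (f n) = g n.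
Proof.
move=> f_inj.
have /choice[s sP] : forall x, exists a, forall n, f n = x -> a = g n.
  move=> x; have [[n <-]|nx] := pselect (exists n, f n = x).
    by exists (g n) => m /f_inj ->.
  by exists Top => n fn; case: nx; exists n.
by exists s => n; apply: sP.
Qed.

(** The axioms mention at most three propositional variables, so this turns each of them into a
    schema over arbitrary formulas. *)
Lemma subst3 (Var Nom : Type) : denumerable Var -> exists p q r : Var,
  forall a b c : form Var Nom, exists s, [/\ s p = a, s q = b & s r = c].
Proof.
move=> [f /bij_inj f_inj]; exists (f 0), (f 1), (f 2) => a b c.
by have [s sE] := subst_onto (fun n => nth Top [:: a; b; c] n) f_inj; exists s.
Qed.

(** * Schematic forms of the axioms *)

Section Schemes.
Variables (Var Nom : Type).
Hypothesis Var_inf : denumerable Var.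
Implicit Types (i j k : Nom) (a b c d : form Var Nom).

Lemma pr_dual a b :
  provable ((¬ ⟨B⟩(a, b)) ↔ [B](¬ a, ¬ b))%hyb.
Proof.
have [p [q [r sE]]] := subst3 Nom Var_inf; have [s [<- <- _]] := sE a b Top.
exact: (Pr_subst s id (Pr_hybrid (Ax_dual Nom p q))).
Qed.

Lemma pr_K1 a b c :
  provable ([B](a → b, c) → ([B](a, c) → [B](b, c)))%hyb.
Proof.
have [p [q [r sE]]] := subst3 Nom Var_inf; have [s [<- <- <-]] := sE a b c.
exact: (Pr_subst s id (Pr_hybrid (Ax_K1 Nom p q r))).
Qed.

Lemma pr_K2 a b c :
  provable ([B](c, a → b) → ([B](c, a) → [B](c, b)))%hyb.
Proof.
have [p [q [r sE]]] := subst3 Nom Var_inf; have [s [<- <- <-]] := sE a b c.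
exact: (Pr_subst s id (Pr_hybrid (Ax_K2 Nom p q r))).
Qed.

Lemma pr_K_at i a b :
  provable ((@[i] (a → b)) → ((@[i] a) → (@[i] b)))%hyb.
Proof.
have [p [q [r sE]]] := subst3 Nom Var_inf; have [s [<- <- _]] := sE a b Top.
exact: (Pr_subst s id (Pr_hybrid (Ax_K_at i p q))).
Qed.

Lemma pr_selfdual i a : provable ((¬ @[i] a) ↔ (@[i] ¬ a))%hyb.
Proof.
have [p [q [r sE]]] := subst3 Nom Var_inf; have [s [<- _ _]] := sE a Top Top.
exact: (Pr_subst s id (Pr_hybrid (Ax_selfdual i p))).
Qed.

Lemma pr_intro i a : provable (Nml i ∧ a → @[i] a)%hyb.
Proof.
have [p [q [r sE]]] := subst3 Nom Var_inf; have [s [<- _ _]] := sE a Top Top.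
exact: (Pr_subst s id (Pr_hybrid (Ax_intro i p))).
Qed.

Lemma pr_back1 i a b : provable (⟨B⟩(@[i] a, b) → @[i] a)%hyb.
Proof.
have [p [q [r sE]]] := subst3 Nom Var_inf; have [s [<- <- _]] := sE a b Top.
exact: (Pr_subst s id (Pr_hybrid (Ax_back1 i p q))).
Qed.

Lemma pr_back2 i a b : provable (⟨B⟩(b, @[i] a) → @[i] a)%hyb.
Proof.
have [p [q [r sE]]] := subst3 Nom Var_inf; have [s [<- <- _]] := sE a b Top.
exact: (Pr_subst s id (Pr_hybrid (Ax_back2 i p q))).
Qed.

Lemma pr_agree i j a : provable ((@[i] @[j] a) → @[j] a)%hyb.
Proof.
have [p [q [r sE]]] := subst3 Nom Var_inf; have [s [<- _ _]] := sE a Top Top.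
exact: (Pr_subst s id (Pr_hybrid (Ax_agree i j p))).
Qed.

Lemma pr_nom i j a : provable ((@[i] Nml j) ∧ (@[j] a) → @[i] a)%hyb.
Proof.
have [p [q [r sE]]] := subst3 Nom Var_inf; have [s [<- _ _]] := sE a Top Top.
exact: (Pr_subst s id (Pr_hybrid (Ax_nom i j p))).
Qed.

End Schemes.

(** * Maximal consistent sets *)

(** Maximal consistency in the form in which it is used later, as a Boolean valuation making all
    theorems true; [complete_mcs] derives it from maximality. *)
Definition mcs (Var Nom : Type) (M : set (form Var Nom)) : Prop :=
  [/\ forall a, provable a -> M a,
      forall a, M (Neg a) <-> ~ M a &
      forall a b, M (Conj a b) <-> M a /\ M b].

Definition at_set (Var Nom : Type) (M : set (form Var Nom)) (i : Nom) :
  set (form Var Nom) := [set a | M (At i a)].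

Section MaximalSets.
Variables (Var Nom : Type).
Hypothesis Var_inf : denumerable Var.
Implicit Types (M : set (form Var Nom)) (i j k : Nom) (a b c d : form Var Nom).

Lemma mcs_imp M a b : mcs M -> M (a → b)%hyb <-> (M a -> M b).
Proof.
move=> [_ MN MC]; rewrite MN MC MN; split=> [nMab Ma|Mab [/Mab]//].
by apply: contrapT => nMb; apply: nMab.
Qed.

Lemma mcs_iff M a b : mcs M -> M (a ↔ b)%hyb <-> (M a <-> M b).
Proof.
by move=> mM; have [_ _ MC] := mM; rewrite /iff_form MC !mcs_imp.
Qed.

Lemma mcs_MP M a b : mcs M -> provable (a → b)%hyb -> M a -> M b.
Proof. by move=> mM; have [Mth _ _] := mM => /Mth /(mcs_imp _ _ mM). Qed.

Lemma mcs_MP2 M a b c : mcs M -> provable (a ∧ b → c)%hyb -> M a -> M b -> M c.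
Proof.
by move=> mM /(mcs_MP mM); have [_ _ MC] := mM; rewrite MC => h Ma Mb; exact: h.
Qed.

(** Necessitation for [@[i]] handles theorems, self-duality handles negation, and distribution over
    implication handles conjunction. *)
Lemma mcs_at M i : mcs M -> mcs (at_set M i).
Proof.
move=> mM; have [Mth MN MC] := mM.
have mono a b : provable (a → b)%hyb -> M (At i a) -> M (At i b).
  by move=> /(Pr_nec_at i) /(Pr_MP (pr_K_at Var_inf i a b)) /(mcs_MP mM).
split=> [a /(Pr_nec_at i) /Mth //|a|a b]; rewrite /at_set /=.
  by have /(mcs_iff _ _ mM) <- := Mth _ (pr_selfdual Var_inf i a).
split=> [Mab|[Ma Mb]].
  by split; apply: mono Mab; tautology.
have /mono/(_ Ma) : provable (a → (b → a ∧ b))%hyb by tautology.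
by move=> /(mcs_MP mM (pr_K_at Var_inf i _ _)) /(mcs_imp _ _ mM); apply.
Qed.

(** When [M] contains [Nml i], it coincides with [at_set M i]. The converse direction applies the
    introduction axiom to [¬ a] and then self-duality. *)
Lemma mcs_at_intro M i a : mcs M -> M (Nml i) -> M (At i a) <-> M a.
Proof.
move=> mM Mi; have [_ MN _] := mM.
have intro b : M b -> M (At i b) by exact: mcs_MP2 (pr_intro Var_inf i b) Mi.
split=> [Mia|]; last exact: intro.
apply: contrapT => /MN /intro.
by have [/(_ _ (pr_selfdual Var_inf i a)) /(mcs_iff _ _ mM) <- _ _] := mM => /MN.
Qed.

Lemma mcs_dual M a b : mcs M -> M ([B](¬ a, ¬ b))%hyb <-> ~ M ⟨B⟩(a, b)%hyb.
Proof.
move=> mM; have [Mth MN _] := mM.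
by have /(mcs_iff _ _ mM) <- := Mth _ (pr_dual Var_inf a b).
Qed.

(** If both diamonds on the right failed, their dual boxes would hold, and two uses of K in the
    first argument would yield the box refuting [⟨B⟩(a, d)]. *)
Lemma mcs_dia_or1 M a b c d : mcs M -> provable (a → b ∨ c)%hyb ->
  M ⟨B⟩(a, d)%hyb -> M ⟨B⟩(b, d)%hyb \/ M ⟨B⟩(c, d)%hyb.
Proof.
move=> mM abc Mad; have [Mth _ _] := mM.
apply: contrapT => /not_orP[/(mcs_dual _ _ mM) Mb /(mcs_dual _ _ mM) Mc].
have: provable ((¬ b) → ((¬ c) → ¬ a))%hyb by apply: Pr_MP abc; tautology.
move=> /(Pr_nec1 (Neg d)) /(Pr_MP (pr_K1 Var_inf _ _ _)).
move=> /(mcs_MP mM) /(_ Mb) /(mcs_MP mM (pr_K1 Var_inf _ _ _)) /(mcs_imp _ _ mM).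
by move=> /(_ Mc) /(mcs_dual _ _ mM).
Qed.

Lemma mcs_dia_or2 M a b c d : mcs M -> provable (a → b ∨ c)%hyb ->
  M ⟨B⟩(d, a)%hyb -> M ⟨B⟩(d, b)%hyb \/ M ⟨B⟩(d, c)%hyb.
Proof.
move=> mM abc Mad; have [Mth _ _] := mM.
apply: contrapT => /not_orP[/(mcs_dual _ _ mM) Mb /(mcs_dual _ _ mM) Mc].
have: provable ((¬ b) → ((¬ c) → ¬ a))%hyb by apply: Pr_MP abc; tautology.
move=> /(Pr_nec2 (Neg d)) /(Pr_MP (pr_K2 Var_inf _ _ _)).
move=> /(mcs_MP mM) /(_ Mb) /(mcs_MP mM (pr_K2 Var_inf _ _ _)) /(mcs_imp _ _ mM).
by move=> /(_ Mc) /(mcs_dual _ _ mM).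
Qed.

Lemma pr_at_split j a : provable (Nml j → a ∨ @[j] ¬ a)%hyb.
Proof. by apply: Pr_MP (pr_intro Var_inf j (¬ a)%hyb); tautology. Qed.

(** Split [Nml j] into [a] or [@[j] ¬ a] under the diamond. The second alternative escapes the
    diamond by the Back axiom and contradicts [@[j] a]. The other argument is treated likewise. *)
Lemma mcs_bridge M j k a b : mcs M -> M ⟨B⟩(Nml j, Nml k)%hyb ->
  M (At j a) -> M (At k b) -> M ⟨B⟩(a, b)%hyb.
Proof.
move=> mM Mjk Mja Mkb; have [Mth MN _] := mM.
have notboth i c : M (At i c) -> M (At i (Neg c)) -> False.
  by have /(mcs_iff _ _ mM) <- := Mth _ (pr_selfdual Var_inf i c) => Mc /MN.
have [Mak|] := mcs_dia_or1 mM (pr_at_split j a) Mjk; last first.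
  by move=> /(mcs_MP mM (pr_back1 Var_inf _ _ _)) /(notboth _ _ Mja).
have [//|] := mcs_dia_or2 mM (pr_at_split k b) Mak.
by move=> /(mcs_MP mM (pr_back2 Var_inf _ _ _)) /(notboth _ _ Mkb).
Qed.

End MaximalSets.
(** * Lindenbaum's construction *)

Notation bigconj := (foldr (@Conj _ _) Top).

Lemma List_Forall_cat (T : Type) (P : T -> Prop) (s t : seq T) :
  List.Forall P s -> List.Forall P t -> List.Forall P (s ++ t).
Proof. by move=> Ps Pt; apply/List.Forall_app. Qed.

Lemma bigconj_cat (Var Nom : Type) (s t : seq (form Var Nom)) :
  provable (bigconj (s ++ t) → bigconj s ∧ bigconj t)%hyb.
Proof.
elim: s => [|a s IH] /=; first by tautology.
by apply: Pr_MP IH; tautology.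
Qed.

Section Consistency.
Variables (Var Nom : Type).
Implicit Types (X Y : set (form Var Nom)) (a b : form Var Nom).

Lemma consistent_sub X Y : X `<=` Y -> consistent Y -> consistent X.
Proof. by move=> XY cY s sX; apply: cY; apply: List.Forall_impl sX. Qed.

(** A deduction theorem: all occurrences of [a] in the refuted list are discharged into a single
    premise. *)
Lemma inconsistent_add X a : ~ consistent (a |` X) ->
  exists2 s, List.Forall X s & provable (a → ¬ bigconj s)%hyb.
Proof.
have discharge s : List.Forall (a |` X) s ->
    exists2 t, List.Forall X t & provable (a ∧ bigconj t → bigconj s)%hyb.
  elim=> [|b {}s [->|Xb] _ [t Xt ts]]; first by exists [::] => //=; tautology.
  - by exists t => //=; apply: Pr_MP ts; tautology.
  - by exists (b :: t); [constructor|apply: Pr_MP ts => /=; tautology].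
move=> /existsNP[s /not_implyP[/discharge[t Xt ts]]] /contrapT s0; exists t => //.
by apply: Pr_MP s0; apply: Pr_MP ts; tautology.
Qed.

Lemma consistent_split X a :
  consistent X -> consistent (a |` X) \/ consistent ((¬ a)%hyb |` X).
Proof.
move=> cX; apply: contrapT => /not_orP[/inconsistent_add[s Xs sa]].
move=> /inconsistent_add[t Xt ta].
apply: (cX (s ++ t)); first exact: List_Forall_cat.
by apply: Pr_MP ta; apply: Pr_MP sa; apply: Pr_MP (bigconj_cat s t); tautology.
Qed.

(** Any finite list from the union already lies in one stage of the chain. *)
Lemma consistent_bigcup (G : nat -> set (form Var Nom)) :
  (forall m n, m <= n -> G m `<=` G n) -> (forall n, consistent (G n)) ->
  consistent (\bigcup_n G n).
Proof.
move=> G_mono cG s sG; suff [n] : exists n, List.Forall (G n) s by exact: cG.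
elim: sG => [|a {}s [m _ Gma] _ [n Gns]]; first by exists 0.
exists (maxn m n); constructor; first exact: G_mono (leq_maxl m n) _ Gma.
by apply: List.Forall_impl Gns => b; apply: G_mono; exact: leq_maxr.
Qed.

Lemma complete_mcs X : consistent X ->
  (forall a, ~ X a -> ~ consistent (a |` X)) -> mcs X.
Proof.
move=> cX X_max.
have X_neg a : ~ X a -> X (¬ a)%hyb.
  move=> /X_max nca; apply: contrapT => /X_max ncna.
  by have [] := consistent_split a cX.
have X0 a : X a -> ~ provable (¬ a)%hyb.
  move=> Xa na; apply: (cX [:: a]); first by do !constructor.
  by apply: Pr_MP na; tautology.
have X1 a b : X a -> provable (a → b)%hyb -> X b.
  move=> Xa ab; apply: contrapT => /X_neg Xb.
  apply: (cX [:: a; (¬ b)%hyb]); first by do !constructor.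
  by apply: Pr_MP ab; tautology.
have X2 a b c : X a -> X b -> provable (a → (b → c))%hyb -> X c.
  move=> Xa Xb abc; apply: contrapT => /X_neg Xc.
  apply: (cX [:: a; b; (¬ c)%hyb]); first by do !constructor.
  by apply: Pr_MP abc; tautology.
split=> [a pa|a|a b].
- apply: contrapT => /X_neg /X0; apply.
  by apply: Pr_MP pa; tautology.
- split=> [Xna Xa|]; last exact: X_neg.
  have : X (¬ ⊤)%hyb by apply: X2 Xna Xa _; tautology.
  by move=> /X0; apply; tautology.
- split=> [Xab|[Xa Xb]]; last by apply: X2 Xa Xb _; tautology.
  by split; apply: X1 Xab _; tautology.
Qed.

End Consistency.

(** * Enumeration of formulas through codes by finite trees *)

Section FormulaCode.
Variables (Var Nom : Type) (cV : Var -> nat) (cN : Nom -> nat).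

Fixpoint form_code (a : form Var Nom) : GenTree.tree nat :=
  match a with
  | Top => GenTree.Node 0 [::]
  | Prp p => GenTree.Node 1 [:: GenTree.Leaf (cV p)]
  | Nml i => GenTree.Node 2 [:: GenTree.Leaf (cN i)]
  | Neg b => GenTree.Node 3 [:: form_code b]
  | Conj b c => GenTree.Node 4 [:: form_code b; form_code c]
  | Dia b c => GenTree.Node 5 [:: form_code b; form_code c]
  | At i b => GenTree.Node 6 [:: GenTree.Leaf (cN i); form_code b]
  end.

Lemma form_code_inj : injective cV -> injective cN -> injective form_code.
Proof.
move=> cV_inj cN_inj; elim=> [|p|i|a IHa|a IHa b IHb|a IHa b IHb|i a IHa];
  case=> //=.
- by move=> q [/cV_inj ->].
- by move=> j [/cN_inj ->].
- by move=> c [/IHa ->].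
- by move=> c d [/IHa -> /IHb ->].
- by move=> c d [/IHa -> /IHb ->].
- by move=> j c [/cN_inj -> /IHa ->].
Qed.

End FormulaCode.

Lemma form_enum (Var Nom : Type) : denumerable Var -> denumerable Nom ->
  exists e : nat -> form Var Nom, forall a, exists n, e n = a.
Proof.
move=> [f [cV _ cVK]] [g [cN _ cNK]].
have code_inj := form_code_inj (can_inj cVK) (can_inj cNK).
suff /choice[e eP] : forall n, exists a, forall b,
    pickle (form_code cV cN b) = n -> a = b.
  by exists e => a; exists (pickle (form_code cV cN a)); apply: eP.
(* Decode [n] if it is the code of a formula; otherwise the value is the default [Top]. *)
move=> n; have [[b <-]|nb] := pselect (exists b, pickle (form_code cV cN b) = n).
  by exists b => c /(pcan_inj pickleK) /code_inj.
by exists Top => b bn; case: nb; exists b.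
Qed.

(** Even numbers enumerate [T] and odd numbers enumerate the copy of [nat]. *)
Lemma denumerable_sum_nat (T : Type) : denumerable T -> denumerable (T + nat).
Proof.
move=> [f [g fK gK]].
exists (fun n => if odd n then inr n./2 else inl (f n./2)).
exists (fun x => match x with inl t => (g t).*2 | inr n => n.*2.+1 end).
  by move=> n; case: ifP => n_odd; rewrite ?fK -[RHS]odd_double_half n_odd.
by case=> [t|n] /=; rewrite odd_double ?doubleK ?gK //= uphalf_double.
Qed.

Section Lindenbaum.
Variables (Var Nom : Type).
Hypotheses (Var_inf : denumerable Var) (Nom_inf : denumerable Nom).
Local Notation formula := (form Var (Nom + nat)).
Implicit Types (X Y : set formula) (a b c : formula) (i j k : Nom + nat).

(** A uniform bound on the new nominals in use leaves infinitely many of them free, and it survives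
    the addition of finitely many formulas. *)
Definition fresh_from (n : nat) X : Prop :=
  forall m a, n <= m -> X a -> ~ occurs (inr m) a.

Lemma fresh_from_form a : exists n, fresh_from n [set a].
Proof.
rewrite /fresh_from.
have fresh2 b c : (exists n, fresh_from n [set b]) ->
    (exists n, fresh_from n [set c]) ->
    exists n, forall m, n <= m -> ~ (occurs (inr m) b \/ occurs (inr m) c).
  move=> [n nb] [n' nc]; exists (maxn n n') => m; rewrite geq_max => /andP[nm n'm].
  by move=> [|]; [exact: nb nm _|exact: nc n'm _].
have fresh_nom i : exists n, forall m, n <= m -> i <> inr m.
  by case: i => [i|l]; [exists 0|exists l.+1 => m lm [lE]; rewrite lE ltnn in lm].
suff [n nP] : exists n, forall m, n <= m -> ~ occurs (inr m) a.
  by exists n => m _ nm ->; exact: nP.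
have forget b : (exists n, forall m, n <= m -> ~ occurs (inr m) b) ->
    exists n, fresh_from n [set b].
  by move=> [n nP]; exists n => m _ nm ->; exact: nP.
elim: a => [|p|i|b IHb|b IHb c IHc|b IHb c IHc|i b [n IHb]] //=;
  try by exists 0 => m _ [].
- exact: fresh2 (forget _ IHb) (forget _ IHc).
- exact: fresh2 (forget _ IHb) (forget _ IHc).
- have [n' ni] := fresh_nom i; exists (maxn n n') => m; rewrite geq_max.
  by move=> /andP[nm n'm] [|]; [exact: ni|exact: IHb].
Qed.

Lemma fresh_from_add X a :
  (exists n, fresh_from n X) -> exists n, fresh_from n (a |` X).
Proof.
move=> [n nX]; have [n' na] := fresh_from_form a.
exists (maxn n n') => m b; rewrite geq_max => /andP[nm n'm] [Eb|Xb].
  exact: na n'm Eb.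
exact: nX nm Xb.
Qed.

Lemma fresh_from_expand (G : set (form Var Nom)) : fresh_from 0 (expand nat @` G).
Proof.
move=> m _ _ [a _ <-]; by elim: a => [|p|i|b IHb|b IHb c IHc|b IHb c IHc|i b IHb] //= [].
Qed.

Lemma fresh_bigconj X n m s : fresh_from n X -> n <= m -> List.Forall X s ->
  ~ occurs (inr m) (bigconj s).
Proof.
by move=> nX nm; elim=> [//|a {}s Xa _ IH] /= []; [exact: nX nm Xa|exact: IH].
Qed.

(** A refutation would derive [¬ bigconj s] from a nominal that does not occur in it, so the rule
    Name would make it a theorem. *)
Lemma consistent_name X n :
  fresh_from n X -> consistent X -> consistent (Nml (inr n) |` X).
Proof.
move=> nX cX; apply: contrapT => /inconsistent_add[s Xs s0].
apply: (cX s Xs); apply: Pr_name s0; exact: fresh_bigconj nX (leqnn n) Xs.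
Qed.

Definition witness i j k b c : formula :=
  ((@[i] ⟨B⟩(Nml j, Nml k)) ∧ (@[j] b) ∧ (@[k] c))%hyb.

Definition pasted X a : Prop := forall i b c, a = (@[i] ⟨B⟩(b, c))%hyb ->
  exists j k, X (witness i j k b c).

(** A refutation of the witness has exactly the shape of the premise of Paste, whose conclusion
    would then refute the diamond formula itself. *)
Lemma paste_consistent X i b c :
  (exists n, fresh_from n X) -> consistent ((@[i] ⟨B⟩(b, c))%hyb |` X) ->
  exists j k, consistent (witness i j k b c |` ((@[i] ⟨B⟩(b, c))%hyb |` X)).
Proof.
set a := (@[i] ⟨B⟩(b, c))%hyb => /(fresh_from_add a)[n nX] ca.
(* The bound [n] also covers the diamond formula, so these two nominals differ from [i] and are
   absent from [b], [c] and the refuted list. *)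
exists (inr n), (inr n.+1); apply: contrapT => /inconsistent_add[s Xs sE].
have fresh_s l : n <= l -> ~ occurs (inr l) (bigconj s).
  by move=> nl; exact: fresh_bigconj nX nl Xs.
have fresh_a l : n <= l -> ~ occurs (inr l) a by move=> nl; apply: nX nl _; left.
have /not_orP[ni /not_orP[nb nc]] := fresh_a n (leqnn n).
have /not_orP[n1i /not_orP[n1b n1c]] := fresh_a n.+1 (leqnSn n).
have dist : distinct3 i (inr n) (inr n.+1).
  by split=> // -[/eqP]; rewrite eqn_leq ltnn andbF.
have as_incons : provable (a → ¬ bigconj s)%hyb.
  apply: (Pr_paste dist _ _ _ _ _ _ sE) => //=; exact: fresh_s.
apply: (ca (a :: s)); first by constructor; [left|].
by apply: Pr_MP as_incons; tautology.
Qed.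

Definition extendible X : Prop := consistent X /\ exists n, fresh_from n X.

Lemma lindenbaum_step X a : extendible X -> exists Y,
  [/\ extendible Y, X `<=` Y &
      ~ consistent (a |` Y) \/ (Y a /\ pasted Y a)].
Proof.
move=> [cX fX]; have [ca|nca] := pselect (consistent (a |` X)); last first.
  by exists X; split=> //; left.
have [[i [b [c aE]]]|na] := pselect (exists i b c, a = (@[i] ⟨B⟩(b, c))%hyb).
  rewrite aE in ca *; have [j [k cjk]] := paste_consistent fX ca.
  eexists; split; [split; [exact: cjk|]| |right; split].
  - by do 2!apply: fresh_from_add.
  - by move=> d Xd; right; right.
  - by right; left.
  - by move=> i' b' c' [<- <- <-]; exists j, k; left.
exists (a |` X); split; [split=> //; exact: fresh_from_add|by move=> b; right|].
by right; split; [left|move=> i b c aE; case: na; exists i, b, c].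
Qed.

Lemma lindenbaum X : extendible X ->
  exists M, [/\ X `<=` M, mcs M & forall a, M a -> pasted M a].
Proof.
move=> eX; have [e e_onto] : exists e : nat -> formula, forall a, exists n, e n = a.
  exact: form_enum (denumerable_sum_nat Nom_inf).
(* Stages carry their proof of extendibility, so that choice gives a total successor function to
   iterate. *)
have /choice[next nextP] : forall p : {Y | extendible Y} * formula,
    exists Z : {Y | extendible Y}, sval p.1 `<=` sval Z /\
      (~ consistent (p.2 |` sval Z) \/ (sval Z p.2 /\ pasted (sval Z) p.2)).
  move=> [[Y eY] a]; have [Z [eZ YZ Za]] := lindenbaum_step a eY.
  by exists (exist _ Z eZ).
pose G := fix G n := if n is m.+1 then next (G m, e m) else exist _ X eX.
pose M := \bigcup_n sval (G n).
have G_mono m n : m <= n -> sval (G m) `<=` sval (G n).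
  move=> /subnK <-; elim: (n - m) => [|l IH] //=.
  by apply: subset_trans IH _; have [] := nextP (G (l + m), e (l + m)).
have cM : consistent M.
  by apply: consistent_bigcup G_mono _ => n; case: (svalP (G n)).
have GM n : sval (G n) `<=` M by move=> a Ga; exists n.
exists M; split; first exact: GM 0.
  (* A formula outside [M] was not accepted at its turn in the enumeration, hence is inconsistent
     with a stage and so with [M]. *)
  apply: complete_mcs => // a nMa; have [n eE] := e_onto a.
  rewrite -eE in nMa *; have [_ [nc|[/(GM n.+1)]]] := nextP (G n, e n); last by [].
  by apply: contra_not nc; apply: consistent_sub; exact: setUS (GM n.+1).
(* A member of [M] cannot have been rejected at its turn, since [M] is consistent; it was therefore
   accepted together with its witnesses. *)
move=> a Ma i b c aE; have [n eE] := e_onto a.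
have [_ [nc|[_ pa]]] := nextP (G n, e n).
  case: nc; apply: consistent_sub cM => d [->|/(GM n.+1)//] /=.
  by rewrite eE.
have [j [k Gjk]] := pa i b c (etrans eE aE).
by exists j, k; exact: (GM n.+1).
Qed.

End Lindenbaum.

(** * The canonical model *)

Section Canonical.
Variables (Var Nom : Type) (M : set (form Var Nom)).
Hypotheses (Var_inf : denumerable Var) (mM : mcs M).
Hypothesis M_pasted : forall i b c, M (@[i] ⟨B⟩(b, c))%hyb -> exists j k,
  [/\ M (@[i] ⟨B⟩(Nml j, Nml k))%hyb, M (@[j] b)%hyb & M (@[k] c)%hyb].
Implicit Types (i j k : Nom) (a b c : form Var Nom).

Lemma M_ref i : M (At i (Nml i)).
Proof. by have [Mth _ _] := mM; apply/Mth/Pr_hybrid/Ax_ref. Qed.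

Lemma M_sym i j : M (At i (Nml j)) -> M (At j (Nml i)).
Proof. by apply: mcs_MP mM _; apply/Pr_hybrid/Ax_sym. Qed.

Lemma M_at_congr i j a : M (At i (Nml j)) -> M (At i a) <-> M (At j a).
Proof.
move=> Mij; split; first exact: mcs_MP2 mM (pr_nom Var_inf _ _ _) (M_sym Mij).
exact: mcs_MP2 mM (pr_nom Var_inf _ _ _) Mij.
Qed.

(** For the converse of the axiom: if [@[i] @[j] a] is not in [M], self-duality used twice puts
    [@[i] @[j] ¬ a] in [M], hence [@[j] ¬ a]. *)
Lemma M_agree i j a : M (At i (At j a)) <-> M (At j a).
Proof.
have agree b : M (At i (At j b)) -> M (At j b).
  exact: mcs_MP mM (pr_agree Var_inf i j b).
split; first exact: agree.
move=> Mja; have [_ iN _] := mcs_at Var_inf i mM; apply: contrapT => /iN.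
have [iTh _ _] := mcs_at Var_inf i mM.
have /(mcs_iff _ _ (mcs_at Var_inf i mM)) -> := iTh _ (pr_selfdual Var_inf j a).
move=> /agree; have [_ jN _] := mcs_at Var_inf j mM.
by move=> /jN; apply.
Qed.

Definition class i : set Nom := [set j | M (At i (Nml j))].

Lemma class_eq i j : class i = class j <-> M (At i (Nml j)).
Proof.
split=> [|Mij]; first by move=> E; have: class j j by [exact: M_ref]; rewrite -E.
by apply/seteqP; split=> k /(M_at_congr _ Mij).
Qed.

Definition canonical_point := {X : set Nom | exists i, X = class i}.

Definition cls i : canonical_point := exist _ (class i) (ex_intro _ i erefl).

Definition rep (w : canonical_point) : Nom := sval (cid (svalP w)).

Lemma repK : cancel rep cls.
Proof. by case=> X Xi; apply/eq_exist; rewrite /rep; case: cid => i /= ->. Qed.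

Lemma cls_eq i j : cls i = cls j <-> M (At i (Nml j)).
Proof. by rewrite -class_eq; split=> [[]//|E]; exact/eq_exist. Qed.

Lemma rep_cls i a : M (At (rep (cls i)) a) <-> M (At i a).
Proof. by apply: M_at_congr; apply/cls_eq; rewrite repK. Qed.

(** Betweenness is read off chosen representatives; [mcs_bridge] transfers it to the other names of
    the same points. *)
Definition canonical_frame : frame :=
  Frame (fun x y z : canonical_point =>
    M (At (rep y) (Dia (Nml (rep x)) (Nml (rep z))))).

Definition canonical_val (l : Var + Nom) : set canonical_frame :=
  match l with
  | inl p => [set w | M (At (rep w) (Prp p))]
  | inr i => [set cls i]
  end.

Lemma canonical_val_nom i : exists w, canonical_val (inr i) = [set w].
Proof. by exists (cls i). Qed.

Definition canonical_valuation : valuation canonical_frame Var Nom :=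
  Valuation canonical_val_nom.

Lemma canonical_named : named canonical_valuation.
Proof. by move=> w; exists (rep w); rewrite /= repK. Qed.

Lemma truth a (w : canonical_frame) :
  sat canonical_valuation w a <-> M (At (rep w) a).
Proof.
have mw (v : canonical_point) := mcs_at Var_inf (rep v) mM.
elim: a w => [|p|i|a IHa|a IHa b IHb|a IHa b IHb|i a IHa] w //=.
- by split=> // _; have [Mth _ _] := mw w; apply: Mth; tautology.
- rewrite -cls_eq repK; split=> [E|->//].
  by have : [set cls i] (cls i) by []; rewrite E.
- by have [_ iN _] := mw w; rewrite IHa; apply: iff_sym; exact: iN.
- by have [_ _ iC] := mw w; rewrite IHa IHb; apply: iff_sym; exact: iC.
(* Forwards, [mcs_bridge] replaces the names of [x] and [y] by the formulas true there. Backwards,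
   pasting supplies names [j], [k], and the bridge exchanges them for the representatives of their
   classes. *)
- split=> [[x [y [/IHa xa /IHb yb xwy]]]|/M_pasted[j [k [wjk ja kb]]]].
    by apply: (mcs_bridge Var_inf (mw w) xwy); apply/M_agree.
  exists (cls j), (cls k); split; [exact/IHa/rep_cls|exact/IHb/rep_cls|].
  apply: (mcs_bridge Var_inf (mw w) wjk); apply/M_agree.
    by apply/cls_eq; rewrite repK.
  by apply/cls_eq; rewrite repK.
- rewrite M_agree -rep_cls -IHa; split=> [[u -> //]|ia].
  by exists (cls i).
Qed.

End Canonical.

(** * Betweenness axioms and dense linear betweenness *)

Section Satisfaction.
Variables (F : frame) (Var Nom : Type) (V : valuation F Var Nom).
Implicit Types (w x y : F) (i j : Nom) (a b : form Var Nom).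

Lemma sat_neg w a : sat V w (¬ a)%hyb = (~ sat V w a).
Proof. by []. Qed.

Lemma sat_conj w a b : sat V w (a ∧ b)%hyb = (sat V w a /\ sat V w b).
Proof. by []. Qed.

Lemma sat_imp w a b : sat V w (a → b)%hyb = (sat V w a -> sat V w b).
Proof.
rewrite propeqE; split=> /= [nab wa|ab [/ab] //].
by apply: contrapT => wb; apply: nab.
Qed.

Lemma sat_or w a b : sat V w (a ∨ b)%hyb = (sat V w a \/ sat V w b).
Proof. by rewrite /= -not_orE notK. Qed.

Lemma sat_nom i w x : V (inr i) = [set x] -> sat V w (Nml i) = (w = x).
Proof.
rewrite propeqE /= => ->; split=> [E|->//].
by have : [set x] x by []; rewrite E.
Qed.

Lemma sat_at i w x a : V (inr i) = [set x] -> sat V w (At i a) = sat V x a.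
Proof.
by rewrite propeqE /= => ->; split=> [[_ -> //]|xa]; exists x.
Qed.

Lemma sat_dia i j w x y : V (inr i) = [set x] -> V (inr j) = [set y] ->
  sat V w (Dia (Nml i) (Nml j)) = btw x w y.
Proof.
move=> Vi Vj; rewrite propeqE; split=> [[x' [y' [Vx' Vy']]]|xwy].
  have -> : x = x' by apply: esym; rewrite -(sat_nom x' Vi).
  by have -> : y = y' by apply: esym; rewrite -(sat_nom y' Vj).
by exists x, y.
Qed.

End Satisfaction.

(** Since every point has a name, instances of the axioms at names are first-order statements about
    arbitrary points. Only density requires a geometric argument. *)
Lemma named_DLBWE (F : frame) (Var Nom : Type) (V : valuation F Var Nom) :
  named V -> (forall a w, betweenness_axiom a -> sat V w a) -> DLBWE F.
Proof.
move=> /choice[n nP] ax.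
have dia x y w : sat V w (Dia (Nml (n x)) (Nml (n y))) = btw x w y.
  exact: sat_dia.
have at_ x a w : sat V w (At (n x) a) = sat V x a by exact: sat_at.
have nom x w : sat V w (Nml (n x)) = (w = x) by exact: sat_nom.
pose satE := (sat_or, sat_imp, sat_conj, sat_neg, at_, dia, nom).
have b1 (x y z : F) : btw x y z -> distinct3 x y z.
  have := ax _ y (HB1 Var (n y) (n x) (n z)); rewrite !satE => h /h[yx [yz zx]].
  by split=> E; [apply: yx|apply: zx|apply: yz].
have b2 (x y z : F) : btw x y z -> btw z y x.
  by have := ax _ y (HB2 Var (n x) (n z)); rewrite !satE.
have b3 (x y z : F) : btw x y z -> ~ btw x z y.
  by have := ax _ y (HB3 Var (n x) (n y) (n z)); rewrite !satE.
have b4 (x y z u : F) : btw x y z /\ btw y z u -> btw x y u.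
  by have := ax _ y (HB4 Var (n x) (n y) (n z) (n u)); rewrite !satE => h /h[].
have b5 (x y z u : F) : btw x y z /\ btw y u z -> btw x y u.
  (* (HB5) places the inner triple at the opposite end, so it is applied to the reversed triples,
     and its second conclusion is the one needed. *)
  have := ax _ y (HB5 Var (n z) (n y) (n x) (n u)); rewrite !satE => h.
  by move=> [/b2 zyx /b2 zuy]; apply: b2; have [] := h (conj zyx zuy).
have b6 (x y z : F) : distinct3 x y z -> btw x y z \/ btw x z y \/ btw y x z.
  have := ax _ y (HB6 Var (n x) (n y) (n z)); rewrite !satE => h [xy xz yz].
  by apply: h; split=> //; split=> // /esym.
have b7 (y : F) : exists x z, btw x y z.
  by have [x [z [_ _ xyz]]] := ax _ y (HB7 Var Nom); exists x, z.
split=> // x z xz.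
(* [HB8'] only speaks about pairs with a point in between; [HB7] provides such
   a pair, with [z] in between and [x] as one of its ends. *)
have [u xzu] : exists u, btw x z u.
  have [u [v uzv]] := b7 z; have [uz uv zv] := b1 _ _ _ uzv.
  have [xu|xu] := pselect (x = u); first by exists v; rewrite xu.
  have [|xzu|[xuz|zxu]] := b6 x z u; first by split=> // /esym.
  - by exists u.
  - by exists v; apply/b2/(b4 _ _ u); split; exact: b2.
  - by exists v; apply/b2/(b5 _ _ u); split; [exact: b2|].
(* The axiom gives [a] and [b] around [z], both strictly between [x] and [u]. Each lies either
   between [x] and [z], as desired, or beyond [z] as seen from [x]. *)
have := ax _ z (HB8' Var (n x) (n u)); rewrite sat_imp dia => /(_ xzu).
move=> [a [b [Ca Cb azb]]].
have inside c : sat V c (C (Nml (n x) ∨ Nml (n u))%hyb) -> btw x c u.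
  have ends d : sat V d (Nml (n x) ∨ Nml (n u))%hyb -> d = x \/ d = u.
    by rewrite !satE.
  move=> [d [e [/(ends d)[]-> /(ends e)[]-> dce]]] //.
  + by have [] := b1 _ _ _ dce.
  + exact: b2.
  + by have [] := b1 _ _ _ dce.
have side c : btw x c u -> c <> z -> btw x c z \/ btw x z c.
  move=> xcu cz; have [xc xu cu] := b1 _ _ _ xcu.
  have [|xzc|[xcz|zxc]] := b6 x z c; [by split=> // /esym|by right|by left|].
  case: (b3 u c x); first exact: b2.
  by apply/b2/(b4 _ _ z); split; first exact: b2.
have [az ab zb] := b1 _ _ _ azb.
have [|xaz|xza] := side a (inside a Ca); [by []|by exists a|].
have [|xbz|xzb] := side b (inside b Cb); [by move=> /esym|by exists b|].
have [[xa xa' _] [_ xb _]] := (b1 _ _ _ xza, b1 _ _ _ xzb).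
(* Now [a] and [b] both lie beyond [z], hence on the same side of it, against [btw a z b]; every
   order of [x], [a], [b] is contradictory. *)
have [|xab|[xba|axb]] := b6 x a b; first by [].
- by case: (b3 b z a (b2 _ _ _ azb)); apply: (b5 _ _ x); split; exact: b2.
- by case: (b3 a z b azb); apply: (b5 _ _ x); split; exact: b2.
- by case: (b3 a z x (b2 _ _ _ xza)); apply: (b5 _ _ b); split.
Qed.

Lemma DLBWE_valid (F : frame) (Var Nom : Type) (a : form Var Nom) :
  DLBWE F -> betweenness_axiom a -> valid F a.
Proof.
move=> dF aa V w.
have /choice[n nP] := val_nom V.
have dia i j u : sat V u (Dia (Nml i) (Nml j)) = btw (n i) u (n j).
  exact: sat_dia.
have at_ i b u : sat V u (At i b) = sat V (n i) b by exact: sat_at.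
have nom i u : sat V u (Nml i) = (u = n i) by exact: sat_nom.
pose satE := (sat_or, sat_imp, sat_conj, sat_neg, at_, dia, nom).
have b2 (x y z : F) : btw x y z -> btw z y x by exact: (B2 dF).
have b5 (x y z u : F) : btw x y z -> btw x u y -> btw x u z /\ btw u y z.
  move=> xyz xuy; have uyz : btw u y z.
    by apply: (b2); apply: (B5 dF (conj (b2 _ _ _ xyz) (b2 _ _ _ xuy))).
  by split=> //; exact: (B4 dF (conj xuy uyz)).
case: aa => [i j k|i j|i j k|i j k l|i j k l|i j k||i j]; rewrite ?satE.
- by move=> /(B1 dF)[ji jk ik]; split; [|split] => E;
    [exact: ji|exact: ik|exact: jk].
- exact: b2.
- exact: (B3 dF).
- move=> [ijk jkl]; split; first exact: (B4 dF (conj ijk jkl)).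
  by apply: (b2); apply: (B4 dF (conj (b2 _ _ _ jkl) (b2 _ _ _ ijk))).
- by move=> [ijk ilj]; exact: b5 ijk ilj.
- move=> [ij [ik kj]]; apply: (B6 dF); split=> // /esym //.
- by have [x [z xwz]] := B7 dF w; exists x, z.
(* Density on each side of [w] gives points [x] and [y] that are themselves between the values of
   [i] and [j] and have [w] between them. *)
- move=> iwj; have [iw ij wj] := B1 dF iwj.
  have [x ixw] := B8 dF iw; have [y wyj] := B8 dF wj.
  have [ixj xwj] := b5 _ _ _ _ iwj ixw.
  have [jyi ywi] := b5 _ _ _ _ (b2 _ _ _ iwj) (b2 _ _ _ wyj).
  have xwy : btw x w y by apply: (B5 dF (conj xwj wyj)).
  have endi : sat V (n i) (Nml i ∨ Nml j)%hyb by rewrite !satE; left.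
  have endj : sat V (n j) (Nml i ∨ Nml j)%hyb by rewrite !satE; right.
  by exists x, y; split=> //; [exists (n i), (n j)|exists (n j), (n i)].
Qed.

(** * Consistency in the expanded language *)

Lemma subst_comp (V1 V2 V3 N1 N2 N3 : Type) (s : V1 -> form V2 N2) (t : N1 -> N2)
  (s' : V2 -> form V3 N3) (t' : N2 -> N3) a :
  subst s' t' (subst s t a) = subst (fun p => subst s' t' (s p)) (t' \o t) a.
Proof. by elim: a => //= *; congruence. Qed.

Lemma subst_id (Var Nom : Type) (t : Nom -> Nom) (a : form Var Nom) :
  t =1 id -> subst Prp t a = a.
Proof. by move=> tE; elim: a => //= *; rewrite ?tE; congruence. Qed.

Lemma occurs_rename (Var N1 N2 : Type) (t : N1 -> N2) i (a : form Var N1) :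
  injective t -> occurs (t i) (subst Prp t a) -> occurs i a.
Proof.
move=> t_inj; elim: a => //=.
- by move=> j /t_inj.
- by move=> b IHb c IHc [/IHb|/IHc]; [left|right].
- by move=> b IHb c IHc [/IHb|/IHc]; [left|right].
- by move=> j b IHb [/t_inj|/IHb]; [left|right].
Qed.

Lemma bigconj_subst (V1 N1 V2 N2 : Type) (s : V1 -> form V2 N2) (t : N1 -> N2)
  (l : seq (form V1 N1)) :
  subst s t (bigconj l) = bigconj (map (subst s t) l).
Proof. by elim: l => //= a l ->. Qed.

(* Renaming through a bijection keeps the freshness conditions of Name and Paste,
   and conjugates every uniform substitution into another one. *)
Lemma provable_rename (Var N1 N2 : Type) (t : N1 -> N2) (t' : N2 -> N1)
  (a : form Var N1) :
  cancel t t' -> cancel t' t -> provable a -> provable (subst Prp t a).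
Proof.
move=> tK t'K; have t_inj := can_inj tK; elim=> {a} /=.
- move=> a a_taut; apply: Pr_taut => v.
  have -> : beval v (subst Prp t a) = beval (fun b => v (subst Prp t b)) a.
    by elim: a {a_taut} => //= [b ->|b -> c ->].
  exact: a_taut.
- by move=> a [] *; apply: Pr_hybrid; constructor.
- by move=> a [] *; apply: Pr_betweenness; constructor.
- by move=> a b _ ab _; apply: Pr_MP.
- by move=> a b _ IH; apply: Pr_nec1.
- by move=> a b _ IH; apply: Pr_nec2.
- by move=> i a _ IH; apply: Pr_nec_at.
- move=> s r a _ IH; rewrite subst_comp.
  have := Pr_subst (fun p => subst Prp t (s p)) (t \o r \o t') IH.
  rewrite subst_comp; congr provable.
  by elim: (a) => //= *; rewrite ?tK; congruence.
- move=> i c ic _ IH; apply: Pr_name IH.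
  by move=> /(occurs_rename t_inj).
- move=> i j k a b c [ij ik jk] ja jb jc ka kb kc _ IH.
  apply: Pr_paste IH; try by move=> /(occurs_rename t_inj).
  by split=> /t_inj.
Qed.

Lemma consistent_expand (Var Nom : Type) (G : set (form Var Nom)) :
  denumerable Nom -> consistent G -> consistent (expand nat @` G).
Proof.
move=> Nom_inf cG s sG.
have [l Gl ->] : exists2 l, List.Forall G l & s = map (expand nat) l.
  elim: sG => [|a {}s [b Gb <-] _ [l Gl ->]]; first by exists [::].
  by exists (b :: l); first by constructor.
(* Through the two enumerations by [nat], [h \o g] renames the enlarged set of nominals bijectively
   onto the original one. *)
have [f [g fK gK]] := denumerable_sum_nat Nom_inf; have [h [h' hK h'K]] := Nom_inf.
have bK : cancel (h \o g) (f \o h') by apply: can_comp.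
have bK' : cancel (f \o h') (h \o g) by apply: can_comp.
move=> /(provable_rename bK bK') /=; rewrite -(bigconj_subst (@Prp _ _) inl).
(* [r] undoes what the bijection did to the original nominals. *)
pose r i := if f (h' i) is inl j then j else i.
move=> /(Pr_subst Prp r) /=; rewrite !subst_comp subst_id; first exact: cG.
by move=> i; rewrite /r /= hK gK.
Qed.

(** * Reducts to the original nominals, and the theorem *)

Definition restrict (F : frame) (Var Nom New : Type)
    (V : valuation F Var (Nom + New)) : valuation F Var Nom :=
  Valuation (val := fun l => match l with
    | inl p => V (inl p) | inr i => V (inr (inl i)) end)
  (fun i => val_nom V (inl i)).

Lemma sat_restrict (F : frame) (Var Nom New : Type)
    (V : valuation F Var (Nom + New)) w (a : form Var Nom) :
  sat (restrict V) w a <-> sat V w (expand New a).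
Proof.
elim: a w => [|p|i|a IHa|a IHa b IHb|a IHa b IHb|i a IHa] w //=.
- by rewrite IHa.
- by rewrite IHa IHb.
- by split=> -[x [y [xa yb xwy]]]; exists x, y; split=> //;
    [exact/IHa|exact/IHb|exact/IHa|exact/IHb].
- by split=> -[u Vu ua]; exists u => //; exact/IHa.
Qed.

Lemma named_model (Var Nom : Type) (G : set (form Var Nom)) :
  denumerable Var -> denumerable Nom -> consistent G ->
  exists (F : frame) (V : valuation F Var (Nom + nat)),
    [/\ countable_frame F, named V, DLBWE F &
        exists w : F, forall a, G a -> sat V w (expand nat a)].
Proof.
move=> Var_inf Nom_inf cG.
(* The nominal [inr 0] is fresh for the expanded set; its class is the point where [G] will hold. *)
pose here : form Var (Nom + nat) := Nml (inr 0).
have [|M [GM mM M_pasted]] :=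
    @lindenbaum _ _ Var_inf Nom_inf (here |` (expand nat @` G)).
  split; last by apply: fresh_from_add; exists 0; exact: fresh_from_expand.
  exact: consistent_name (fresh_from_expand (G := G)) (consistent_expand Nom_inf cG).
have {}M_pasted i b c : M (@[i] ⟨B⟩(b, c))%hyb -> exists j k,
  [/\ M (@[i] ⟨B⟩(Nml j, Nml k))%hyb, M (@[j] b)%hyb & M (@[k] c)%hyb].
  move=> /M_pasted /(_ i b c erefl)[j [k]]; have [_ _ MC] := mM.
  by move=> /MC[? /MC[? ?]]; exists j, k.
pose V := canonical_valuation M; have sat_M := truth Var_inf mM M_pasted.
have named_V : named V := @canonical_named _ _ M.
exists (canonical_frame M), V; split=> //.
- have [f [g _ gK]] := denumerable_sum_nat Nom_inf.
  apply: (@inj_countable _ (g \o @rep _ _ M)).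
  by apply: inj_comp; [exact: can_inj gK|exact: can_inj (repK (M := M))].
(* Each betweenness axiom is a theorem, so its [@] necessitation at any name is in [M], and the
   axiom is true at every point. *)
- apply: named_DLBWE named_V _ => a w /Pr_betweenness /(Pr_nec_at (rep w)) a_th.
  by apply/sat_M; have [Mth _ _] := mM; exact: Mth.
- exists (cls M (inr 0)) => a Ga; apply/sat_M/(rep_cls Var_inf mM).
  have M0 : M here by apply: GM; left.
  by apply/(mcs_at_intro Var_inf _ mM M0)/GM; right; exists a.
Qed.

Theorem theorem7p10 (Var Nom : Type)
    (Var_count : ([set: Var] #= [set: nat])%card)
    (Nom_count : ([set: Nom] #= [set: nat])%card) :
  (forall G : set (form Var Nom), consistent G ->
     exists (F : frame) (V : valuation F Var (Nom + nat)),
       [/\ countable_frame F,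
           named V,
           exists w : F, forall a, G a -> sat V w (expand nat a) &
           forall a : form Var Nom, betweenness_axiom a -> valid F a]) /\
  (forall G : set (form Var Nom), consistent G ->
     exists F : frame,
       [/\ countable_frame F,
           DLBWE F &
           exists (V : valuation F Var Nom) (w : F), forall a, G a -> sat V w a]).
Proof.
have Var_inf := card_nat_denumerable Var_count.
have Nom_inf := card_nat_denumerable Nom_count.
split=> G /(named_model Var_inf Nom_inf)[F [V [cF nV dF [w wG]]]].
  by exists F, V; split=> // [|a]; [exists w|exact: DLBWE_valid].
exists F; split=> //; exists (restrict V), w => a /wG.
by rewrite sat_restrict.
Qed.
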